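(* Let $X,Y$ be real Banach spaces with $X$ reflexive. Suppose $Z$ is a closed subspace of $Y$ such that $Z$ is an $L^1$-predual space and an $M$-ideal in $Y$. Let $T\in\mathcal{K}(X,Y)$ be a multi-smooth operator of finite order such that $T\perp_B\mathcal{L}(X,Z)$. Then for some $x_0\in M_T$ the following hold. (i) $d(T,\mathcal{L}(X,Z))=\sup_{x\in S_X}d(Tx,Z)=d(Tx_0,Z)$. (ii) $Tx_0\perp_B Z^{\perp\perp}$. (iii) $T\perp_B\mathcal{L}(X,Z^{\perp\perp})$.
   Context: All Banach spaces are real, and every Banach space is regarded as canonically embedded in its bidual. $\mathcal{L}(X,Y)$ (respectively $\mathcal{K}(X,Y)$) is the space of bounded (respectively compact) linear operators with the operator norm; for a subspace $Z\subset Y$, $\mathcal{L}(X,Z)$ is regarded as a subspace of $\mathcal{L}(X,Y)$. $S_X$ is the unit sphere of $X$. $M_T=\{x\in S_X:\|Tx\|=\|T\|\}$. For a subspace $W$ of a normed space $V$ and $v\in V$, $d(v,W)=\inf_{w\in W}\|v-w\|$. Birkhoff-James orthogonality: $v\perp_B w$ means $\|v+\lambda w\|\ge\|v\|$ for all scalars $\lambda$; $v\perp_B W$ means $v\perp_B w$ for all $w\in W$. $Z^\perp=\{y^*\in Y^*:y^*(z)=0\ \forall z\in Z\}$ and $Z^{\perp\perp}\subset Y^{**}$ is the annihilator of $Z^\perp$. In (ii), $Tx_0$ is viewed in $Y^{**}$; in (iii), $T$ is viewed as an element of $\mathcal{L}(X,Y^{**})$, of which $\mathcal{L}(X,Z^{\perp\perp})$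 is a subspace. A non-zero $T\in\mathcal{L}(X,Y)$ is a multi-smooth operator of finite order if the linear span of $J(T)=\{f\in S_{\mathcal{L}(X,Y)^*}:f(T)=\|T\|\}$ is finite-dimensional. A Banach space $V$ is an $L^1$-predual space if $V^*$ is isometrically isomorphic to $L^1(\mu)$ for some positive measure $\mu$. A closed subspace $Z$ of $Y$ is an $M$-ideal in $Y$ if there is a linear projection $P:Y^*\to Y^*$ with $\ker P=Z^\perp$ and $\|y^*\|=\|Py^*\|+\|y^*-Py^*\|$ for all $y^*\in Y^*$. *)

(* Defs.v *)
From HB Require Import structures.
From mathcomp Require Import all_boot all_order all_algebra.
From mathcomp Require Import ring_quotient.
From mathcomp Require Import all_classical all_reals all_analysis.
From mathcomp Require Import measurable_realfun.

Set Implicit Arguments.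
Unset Strict Implicit.
Unset Printing Implicit Defensive.

Import Order.TTheory GRing.Theory Num.Theory.
Import numFieldNormedType.Exports.

Local Open Scope classical_set_scope.
Local Open Scope ring_scope.

Section BoundedOp.
Context {R : realType} (X Y : normedModType R).

Definition is_bounded_linear (f : X -> Y) : Prop :=
  linear f /\ exists M : R, forall x, `|f x| <= M * `|x|.

Definition bounded_linear_pred : {pred X -> Y} :=
  fun f => `[< is_bounded_linear f >].

Record bounded_op := BoundedOp {
  bounded_op_fun :> X -> Y;
  _ : bounded_op_fun \in bounded_linear_pred }.

HB.instance Definition _ := [isSub for bounded_op_fun].
HB.instance Definition _ := [Choice of bounded_op by <:].

Lemma bounded_linear_submod_closed : submod_closed bounded_linear_pred.
Proof.
split=> [|a f g /asboolP[lf [M fM]] /asboolP[lg [N gN]]]; apply/asboolP.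
  split; first by move=> a x y; rewrite /GRing.zero/= /cst scaler0 addr0.
  by exists 0 => x; rewrite /GRing.zero/= /cst normr0 mul0r.
have E x : (a *: f + g) x = a *: f x + g x by [].
split=> [b x y|].
  by rewrite !E lf lg !scalerDr !scalerA [a * b]mulrC addrACA.
exists (`|a| * M + N) => x; rewrite E mulrDl.
apply: (le_trans (ler_normD _ _)); apply: lerD; last exact: gN.
by rewrite normrZ -mulrA; apply: ler_wpM2l.
Qed.

HB.instance Definition _ :=
  GRing.isSubmodClosed.Build R (X -> Y) bounded_linear_pred
    bounded_linear_submod_closed.
HB.instance Definition _ := [SubChoice_isSubLmodule of bounded_op by <:].

Lemma bounded_op_linear (f : bounded_op) : linear f.
Proof. by case: f => f /= /asboolP[]. Qed.

HB.instance Definition _ (f : bounded_op) :=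
  GRing.isLinear.Build R X Y *:%R f (bounded_op_linear f).

Lemma bounded_op_bounded (f : bounded_op) :
  exists M : R, forall x, `|f x| <= M * `|x|.
Proof. by case: f => f /= /asboolP[]. Qed.

(* The supremum is taken over the closed unit ball rather than the unit sphere
   so that it is also meaningful when X = {0}. *)
Definition opnorm (f : bounded_op) : R :=
  sup [set `|f x| | x in [set x : X | `|x| <= 1]].

Lemma opnorm_has_sup (f : bounded_op) :
  has_sup [set `|f x| | x in [set x : X | `|x| <= 1]].
Proof.
split; first by exists `|f 0|; exists 0 => //=; rewrite normr0.
have [M fM] := bounded_op_bounded f; exists `|M| => _ [x /= x1 <-].
apply: (le_trans (fM x)); apply: (@le_trans _ _ (`|M| * `|x|)).
  by apply: ler_wpM2r => //; exact: ler_norm.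
by rewrite -[leRHS]mulr1; apply: ler_wpM2l.
Qed.

Lemma opnorm_ge1 (f : bounded_op) x : `|x| <= 1 -> `|f x| <= opnorm f.
Proof.
by move=> x1; apply: (ub_le_sup (opnorm_has_sup f).2); exists x.
Qed.

Lemma opnorm_le1 (f : bounded_op) c :
  (forall x, `|x| <= 1 -> `|f x| <= c) -> opnorm f <= c.
Proof.
move=> fc; apply: ge_sup; first exact: (opnorm_has_sup f).1.
by move=> _ [x /= x1 <-]; exact: fc.
Qed.

Lemma opnorm_ge0 (f : bounded_op) : 0 <= opnorm f.
Proof.
by apply: (le_trans _ (@opnorm_ge1 f 0 _)) => //; rewrite normr0.
Qed.

Lemma opnormP (f : bounded_op) x : `|f x| <= opnorm f * `|x|.
Proof.
have [->|x0] := eqVneq x 0; first by rewrite linear0 !normr0 mulr0.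
have nx0 : 0 < `|x| by rewrite normr_gt0.
rewrite -ler_pdivrMr//.
have -> : `|f x| / `|x| = `|f (`|x|^-1 *: x)|.
  by rewrite linearZ/= normrZ normfV normr_id mulrC.
by apply: opnorm_ge1; rewrite normrZ normfV normr_id mulVf ?gt_eqF.
Qed.

Lemma opnormD (f g : bounded_op) : opnorm (f + g) <= opnorm f + opnorm g.
Proof.
apply: opnorm_le1 => x x1; apply: (le_trans (ler_normD (f x) (g x))).
by apply: lerD; exact: opnorm_ge1.
Qed.

Lemma opnormZ (a : R) (f : bounded_op) : opnorm (a *: f) = `|a| * opnorm f.
Proof.
have le (b : R) (g : bounded_op) : opnorm (b *: g) <= `|b| * opnorm g.
  apply: opnorm_le1 => x x1.
  have -> : (b *: g) x = b *: g x by [].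
  by rewrite normrZ; apply: ler_wpM2l => //; exact: opnorm_ge1.
apply/eqP; rewrite eq_le le/=; have [->|a0] := eqVneq a 0.
  by rewrite normr0 mul0r opnorm_ge0.
have := le a^-1 (a *: f); rewrite scalerA mulVf// scale1r normfV.
by rewrite -ler_pdivlMl ?invr_gt0 ?normr_gt0// invrK.
Qed.

Lemma opnorm0_eq0 (f : bounded_op) : opnorm f = 0 -> f = 0.
Proof.
move=> f0; apply/val_inj/funext => x /=; apply/eqP; rewrite -normr_le0.
by have := opnormP f x; rewrite f0 mul0r.
Qed.

HB.instance Definition _ :=
  Lmodule_isNormed.Build R bounded_op opnormD opnormZ opnorm0_eq0.

Lemma bounded_opE (f : bounded_op) : `|f| = opnorm f.
Proof. by []. Qed.

End BoundedOp.

Section Compose.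
Context {R : realType} (X Y W : normedModType R).

Lemma bounded_linear_comp (g : bounded_op Y W) (f : bounded_op X Y) :
  (g : Y -> W) \o f \in @bounded_linear_pred R X W.
Proof.
apply/asboolP; split=> [a x y|]; first by rewrite /= !linearP.
exists (opnorm g * opnorm f) => x /=; apply: (le_trans (opnormP g _)).
by rewrite -mulrA; apply: ler_wpM2l; [exact: opnorm_ge0|exact: opnormP].
Qed.

Definition comp_op (g : bounded_op Y W) (f : bounded_op X Y) :
  bounded_op X W := BoundedOp (bounded_linear_comp g f).

End Compose.

Section Dual.
Context {R : realType}.

Definition dual (X : normedModType R) : Type := bounded_op X R^o.

HB.instance Definition _ (X : normedModType R) :=
  NormedModule.copy (dual X) (bounded_op X R^o).

Context (X : normedModType R).

Lemma eval_bounded (x : X) :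
  (fun f : dual X => f x) \in @bounded_linear_pred R (dual X) R^o.
Proof.
apply/asboolP; split=> [a f g //|]; exists `|x| => f.
by rewrite mulrC; exact: opnormP.
Qed.

Definition eval_at (x : X) : dual (dual X) := BoundedOp (eval_bounded x).

Lemma eval_at_bounded : eval_at \in @bounded_linear_pred R X (dual (dual X)).
Proof.
apply/asboolP; split=> [a x y|].
  by apply/val_inj/funext => f; rewrite /= linearP.
exists 1 => x; rewrite mul1r; apply: opnorm_le1 => f f1.
apply: (le_trans (opnormP (f : bounded_op _ _) x)).
by rewrite -[leRHS]mul1r; apply: ler_wpM2r.
Qed.

Definition bidual_embedding : bounded_op X (dual (dual X)) :=
  BoundedOp eval_at_bounded.

Definition reflexive_space : Prop :=
  forall phi : dual (dual X), exists x : X, bidual_embedding x = phi.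

End Dual.

Section Subspace.
Context {R : realType} (V : normedModType R).

Record lin_subspace := LinSubspace {
  subspace_set :> set V;
  subspace0 : subspace_set 0;
  subspaceP : forall (a : R) u v,
    subspace_set u -> subspace_set v -> subspace_set (a *: u + v) }.

Definition subspace_pred (Z : lin_subspace) : {pred V} := fun v => `[< subspace_set Z v >].

Lemma subspace_submod_closed (Z : lin_subspace) : submod_closed (subspace_pred Z).
Proof.
split=> [|a u v /asboolP Zu /asboolP Zv]; apply/asboolP.
  exact: subspace0.
exact: subspaceP.
Qed.

HB.instance Definition _ (Z : lin_subspace) :=
  GRing.isSubmodClosed.Build R V (subspace_pred Z) (subspace_submod_closed Z).

Record subspace_type (Z : lin_subspace) := SubspaceElt {
  subspace_val :> V;
  _ : subspace_val \in subspace_pred Z }.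

HB.instance Definition _ (Z : lin_subspace) := [isSub for @subspace_val Z].
HB.instance Definition _ (Z : lin_subspace) := [Choice of subspace_type Z by <:].
HB.instance Definition _ (Z : lin_subspace) :=
  [SubChoice_isSubLmodule of subspace_type Z by <:].

Section Norm.
Context (Z : lin_subspace).

Definition subspace_norm (z : subspace_type Z) : R := `|val z|.

Lemma subspace_normD z1 z2 :
  subspace_norm (z1 + z2) <= subspace_norm z1 + subspace_norm z2.
Proof. exact: ler_normD. Qed.

Lemma subspace_normZ (a : R) z :
  subspace_norm (a *: z) = `|a| * subspace_norm z.
Proof. exact: normrZ. Qed.

Lemma subspace_norm0_eq0 z : subspace_norm z = 0 -> z = 0.
Proof. by move=> /normr0_eq0 z0; exact: val_inj. Qed.

HB.instance Definition _ := Lmodule_isNormed.Build R (subspace_type Z)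
  subspace_normD subspace_normZ subspace_norm0_eq0.

End Norm.

End Subspace.

Section AnnihilatorAndOperators.
Context {R : realType}.

(* The annihilator of Z in the dual; in particular
   [annihilator (annihilator Z)] lives in the bidual. *)
Definition annihilator_set (V : normedModType R) (Z : set V) : set (dual V) :=
  [set f | forall z, Z z -> f z = 0].

Lemma annihilator0 (V : normedModType R) (Z : set V) : annihilator_set Z 0.
Proof. by []. Qed.

Lemma annihilatorP (V : normedModType R) (Z : set V) (a : R) (f g : dual V) :
  annihilator_set Z f -> annihilator_set Z g -> annihilator_set Z (a *: f + g).
Proof.
move=> Zf Zg z Zz; have -> : (a *: f + g) z = a *: f z + g z by [].
by rewrite Zf// Zg// scaler0 addr0.
Qed.

Definition annihilator (V : normedModType R) (Z : lin_subspace V) :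
  lin_subspace (dual V) :=
  @LinSubspace R (dual V) (annihilator_set Z)
    (@annihilator0 V Z) (@annihilatorP V Z).

Definition ops_into_set (X Y : normedModType R) (Z : set Y) :
  set (bounded_op X Y) := [set S | forall x, Z (S x)].

Lemma ops_into0 (X Y : normedModType R) (Z : lin_subspace Y) :
  @ops_into_set X Y Z 0.
Proof. by move=> x; exact: (subspace0 Z). Qed.

Lemma ops_intoP (X Y : normedModType R) (Z : lin_subspace Y) (a : R)
    (S1 S2 : bounded_op X Y) :
  ops_into_set Z S1 -> ops_into_set Z S2 -> ops_into_set Z (a *: S1 + S2).
Proof. by move=> ZS1 ZS2 x; exact: (subspaceP a (ZS1 x) (ZS2 x)). Qed.

(* L(X, Z), as a subspace of L(X, Y). *)
Definition ops_into (X Y : normedModType R) (Z : lin_subspace Y) :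
  lin_subspace (bounded_op X Y) :=
  @LinSubspace R (bounded_op X Y) (ops_into_set Z)
    (@ops_into0 X Y Z) (@ops_intoP X Y Z).

End AnnihilatorAndOperators.

Section Geometry.
Context {R : realType} (V : normedModType R).

Definition unit_sphere : set V := [set v | `|v| = 1].

Definition dist_to (v : V) (W : lin_subspace V) : R := inf [set `|v - w| | w in W].

Definition bj_orth (v w : V) : Prop := forall l : R, `|v| <= `|v + l *: w|.

Definition bj_orth_subspace (v : V) (W : lin_subspace V) : Prop :=
  forall w, subspace_set W w -> bj_orth v w.

Definition linear_span (A : set V) : set V :=
  [set v | exists n (c : 'I_n -> R) (a : 'I_n -> V),
     (forall i, A (a i)) /\ v = \sum_(i < n) c i *: a i].

Definition finite_dimensional (W : set V) : Prop :=
  exists n (b : 'I_n -> V), W = linear_span (range b).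

End Geometry.

Arguments unit_sphere {R} V.

Definition support_functionals {R : realType} (V : normedModType R) (v : V) :
    set (dual V) :=
  unit_sphere (dual V) `&` [set f | f v = `|v|].

Definition multi_smooth_finite_order {R : realType} (X Y : normedModType R)
    (T : bounded_op X Y) : Prop :=
  T <> 0 /\ finite_dimensional (linear_span (support_functionals T)).

Definition norm_attaining {R : realType} (X Y : normedModType R)
    (T : bounded_op X Y) : set X :=
  unit_sphere X `&` [set x | `|T x| = `|T|].

Definition compact_op {R : realType} (X Y : normedModType R)
    (T : bounded_op X Y) : Prop :=
  precompact (T @` [set x : X | `|x| <= 1]).

Definition M_ideal {R : realType} (Y : normedModType R) (Z : lin_subspace Y) :
    Prop :=
  closed (Z : set Y) /\
  exists P : {linear dual Y -> dual Y},
    [/\ forall f, P (P f) = P f,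
        [set f | P f = 0] = annihilator Z
      & forall f, `|f| = `|P f| + `|f - P f|].

Section L1.
Context d (T : measurableType d) (R : realType).
Variable mu : {measure set T -> \bar R}.

Local Notation L1fun := (LfunType mu (@lexx _ _ 1%E)).

Definition ae_zero : {pred L1fun} := fun f => `[< (f : T -> R) = cst 0 %[ae mu] >].

Lemma ae_zeroP (f : L1fun) :
  reflect (\forall x \ae mu, f x = 0) (f \in ae_zero).
Proof.
apply: (iffP (asboolP _)); first by apply: filterS => x /(_ I).
by apply: filterS => x /=.
Qed.

Lemma ae_zero_zmod_closed : zmod_closed ae_zero.
Proof.
split; first by apply/ae_zeroP; exact: aeW.
move=> f g /ae_zeroP f0 /ae_zeroP g0; apply/ae_zeroP.
apply: filterS2 f0 g0 => x fx gx.
by have -> : (f - g) x = f x - g x by []; rewrite fx gx subrr.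
Qed.

HB.instance Definition _ :=
  GRing.isZmodClosed.Build L1fun ae_zero ae_zero_zmod_closed.

Local Open Scope quotient_scope.

Definition L1space : Type := Quotient.quot ae_zero.

HB.instance Definition _ := GRing.Zmodule.copy L1space (Quotient.quot ae_zero).
HB.instance Definition _ := EqQuotient.copy L1space (Quotient.quot ae_zero).

Definition L1class (f : L1fun) : L1space := \pi_(Quotient.quot ae_zero) f.

Lemma L1class_eqP (f g : L1fun) :
  L1class f = L1class g <-> \forall x \ae mu, f x = g x.
Proof.
split.
  move=> /eqP; rewrite -Quotient.idealrBE => /ae_zeroP; apply: filterS => x.
  by have -> : (f - g) x = f x - g x by []; move=> /eqP; rewrite subr_eq0 => /eqP.
move=> fg; apply/eqP; rewrite -Quotient.idealrBE; apply/ae_zeroP.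
apply: filterS fg => x fgx.
by have -> : (f - g) x = f x - g x by []; rewrite fgx subrr.
Qed.

Lemma L1class_repr (u : L1space) : L1class (repr u) = u.
Proof. exact: reprK. Qed.

Lemma L1classD (f g : L1fun) : L1class (f + g) = L1class f + L1class g.
Proof. exact: (raddfD (\pi_(Quotient.quot ae_zero))). Qed.

Definition L1scale (a : R) (u : L1space) : L1space := L1class (a *: repr u).

Lemma L1scaleE (a : R) (f : L1fun) : L1scale a (L1class f) = L1class (a *: f).
Proof.
apply/L1class_eqP; have /L1class_eqP := L1class_repr (L1class f).
apply: filterS => x fx.
by rewrite -[LHS]/(a *: repr (L1class f) x) fx.
Qed.

Lemma L1scaleA a b u : L1scale a (L1scale b u) = L1scale (a * b) u.
Proof. by rewrite -[u]L1class_repr !L1scaleE scalerA. Qed.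

Lemma L1scale1 : left_id 1 L1scale.
Proof. by move=> u; rewrite -[u]L1class_repr L1scaleE scale1r. Qed.

Lemma L1scaleDr : right_distributive L1scale +%R.
Proof.
move=> a u v; rewrite -[u]L1class_repr -[v]L1class_repr.
by rewrite -L1classD !L1scaleE scalerDr L1classD.
Qed.

Lemma L1scaleDl u : {morph L1scale^~ u : a b / a + b}.
Proof.
move=> a b; rewrite -[u]L1class_repr !L1scaleE -L1classD.
by rewrite scalerDl.
Qed.

HB.instance Definition _ := GRing.Zmodule_isLmodule.Build R L1space
  L1scaleA L1scale1 L1scaleDr L1scaleDl.

Definition L1norm (u : L1space) : R :=
  fine ('N[mu]_1%:E [EFin \o (repr u : L1fun)])%E.

Lemma L1normE (f : L1fun) :
  L1norm (L1class f) = fine ('N[mu]_1%:E [EFin \o f])%E.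
Proof.
rewrite /L1norm !Lnorm1; congr fine.
have /L1class_eqP h := L1class_repr (L1class f).
have mabs (g : L1fun) :
    measurable_fun [set: T] ((abse : \bar R -> \bar R) \o (EFin \o g)).
  apply: measurableT_comp; first exact: abse_measurable.
  exact/measurable_EFinP.
apply: ge0_ae_eq_integral => //.
- exact: mabs.
- exact: mabs.
- by apply: filterS h => x /= -> _.
Qed.

Lemma L1normD u v : L1norm (u + v) <= L1norm u + L1norm v.
Proof.
rewrite -[u]L1class_repr -[v]L1class_repr -L1classD !L1normE.
exact: ler_LnormD.
Qed.

Lemma L1normZ (a : R) u : L1norm (a *: u) = `|a| * L1norm u.
Proof.
rewrite -[u]L1class_repr -[a *: _]/(L1scale a _) L1scaleE !L1normE.
by rewrite LnormZ fineM//= -finite_norm_fine.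
Qed.

Lemma L1norm0_eq0 u : L1norm u = 0 -> u = 0.
Proof.
rewrite -[u]L1class_repr L1normE => /fine_Lnormr_eq0 u0.
have <- : L1class 0 = 0 :> L1space by exact: (raddf0 (\pi_(Quotient.quot ae_zero))).
by apply/L1class_eqP; apply: filterS u0 => x /(_ I).
Qed.

HB.instance Definition _ := Lmodule_isNormed.Build R L1space
  L1normD L1normZ L1norm0_eq0.

End L1.

Definition isometrically_isomorphic {R : realType} (V W : normedModType R) :
    Prop :=
  exists U : {linear V -> W}, bijective U /\ forall v, `|U v| = `|v|.

Definition L1_predual {R : realType} (V : normedModType R) : Prop :=
  exists (d : measure_display) (T : measurableType d)
    (mu : {measure set T -> \bar R}),
    isometrically_isomorphic (dual V) (L1space mu).

(* Main.v *)
Require Import Defs.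
From HB Require Import structures.
From mathcomp Require Import all_boot all_order all_algebra.
From mathcomp Require Import all_classical all_reals all_analysis.
From mathcomp Require Import ring lra.
Import Order.TTheory GRing.Theory Num.Theory.
Import numFieldNormedType.Exports.

(** All three conclusions come from one pair: a point [x0] of the unit ball of
    [X] and a functional [f] of norm at most 1 that vanishes on [Z], such that
    [f (T x0) = `|T|].  Indeed [f] bounds from below the distance from [T x0]
    to [Z], and evaluation at [f] kills the biannihilator of [Z], so that it
    also bounds from below the norm of every perturbation of [T x0], or of
    [T], by something with values in that biannihilator.  Since [T] is
    orthogonal to the operators into [Z], the distance from [T] to them is
    [`|T|].

    To find the pair, call [(x, f)] norming when both are in the unit balls
    and [f (T x) = `|T|], and suppose that no norming pair has [f] in the
    annihilator of [Z].  Write [P] for the M-ideal projection.  If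
    [(x, f)] is norming and [P f != f], the additivity of the norm makes the
    normalization of [f - P f] norming at [x] too, and it annihilates [Z]
    ([M_ideal_norming_pair]); hence [P f = f] for every norming pair.

    Each norming pair gives the functional [S |-> f (S x)] in [J(T)], whose
    span is finite-dimensional, so finitely many norming pairs [(x_i, f_i)]
    generate all of them ([norming_pairs_finitely_generated]).  There is a
    finite-rank operator [S] into [Z] with [f_i (S x_i) = f_i (T x_i)] for
    all [i]: compose [T] with a finite-rank operator fixing every [x_i], then
    move its finitely many values into [Z] without changing any [f_i].  The
    second step is possible because the range of [P], where the [f_i] live,
    meets the annihilator of [Z] only in 0, so that restricting the [f_i] to
    [Z] creates no new linear relation between them
    ([interpolation_in_subspace]).  By linearity [f (S x) = f (T x) = `|T|]
    for every norming pair.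

    Finally [`|T - l *: S| >= `|T|] for all [l].  Almost norming pairs of
    [T - l *: S], with [l] tending to 0, have a weak limit because [X] is
    reflexive; as [T] is compact and [S] has finite rank, this limit is a
    norming pair of [T] with [f (S x) <= 0]
    ([norming_pair_of_perturbations]), which contradicts
    [f (S x) = `|T| > 0]. *)

Set Implicit Arguments.
Unset Strict Implicit.
Unset Printing Implicit Defensive.

Local Open Scope classical_set_scope.
Local Open Scope ring_scope.

(** * Norming functionals *)

Section HahnBanach.
Context {R : realType} {V : normedModType R}.
Implicit Types (p q : V -> R) (v x y : V).

Definition sublinear p :=
  (forall x y, p (x + y) <= p x + p y) /\
  (forall a x, 0 < a -> p (a *: x) = a * p x).

Lemma sublinear0 p : sublinear p -> p 0 = 0.
Proof.
by move=> [_ pZ]; have := pZ 2 0 (ltr0Sn _ _); rewrite scaler0; lra.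
Qed.

Lemma sublinear_opp p x : sublinear p -> - p (- x) <= p x.
Proof.
move=> sp; have := sp.1 x (- x); rewrite subrr sublinear0//; lra.
Qed.

(** The largest sublinear functional below [p] whose value at [- v] is at
    most [- p v], hence linear along [v] when it keeps the value at [v]. *)
Definition pushed p v x :=
  inf [set p (x + t *: v) - t * p v | t in [set t | 0 <= t]].

Lemma pushed_lb p v x t : sublinear p -> 0 <= t ->
  pushed p v x <= p (x + t *: v) - t * p v.
Proof.
move=> sp t0; apply: ge_inf; last by exists t.
exists (- p (- x)) => _ [s /= s0 <-].
have [->|s0'] := eqVneq s 0.
  by rewrite scale0r addr0 mul0r subr0; exact: sublinear_opp.
have sp0 : 0 < s by rewrite lt_neqAle eq_sym s0'.
have := sp.1 (x + s *: v) (- x); rewrite addrAC subrr add0r sp.2//; lra.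
Qed.

Lemma pushed_glb p v x c :
  (forall t, 0 <= t -> c <= p (x + t *: v) - t * p v) -> c <= pushed p v x.
Proof.
move=> h; apply: lb_le_inf; first by exists (p (x + 0 *: v) - 0 * p v), 0 => /=.
by move=> _ [t /= t0 <-]; exact: h.
Qed.

Lemma pushed_le p v x : sublinear p -> pushed p v x <= p x.
Proof.
move=> sp; have := @pushed_lb p v x 0 sp (lexx 0).
by rewrite scale0r addr0 mul0r subr0.
Qed.

Lemma pushed_opp p v : sublinear p -> pushed p v (- v) <= - p v.
Proof.
move=> sp; have := @pushed_lb p v (- v) 1 sp ler01.
by rewrite scale1r addNr sublinear0// mul1r sub0r.
Qed.

Lemma pushed_sublinear p v : sublinear p -> sublinear (pushed p v).
Proof.
move=> sp; split=> [x y|].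
  rewrite -lerBlDr; apply: pushed_glb => s s0.
  rewrite lerBlDl -lerBlDr; apply: pushed_glb => t t0.
  have := @pushed_lb p v (x + y) (s + t) sp (addr_ge0 s0 t0).
  have := sp.1 (x + s *: v) (y + t *: v).
  rewrite addrACA -scalerDl; lra.
have le a x : 0 < a -> pushed p v (a *: x) <= a * pushed p v x.
  move=> a0; rewrite -ler_pdivrMl//; apply: pushed_glb => t t0.
  rewrite ler_pdivrMl//.
  have := @pushed_lb p v (a *: x) (a * t) sp (mulr_ge0 (ltW a0) t0).
  by rewrite -scalerA -scalerDr sp.2//; lra.
move=> a x a0; apply/eqP; rewrite eq_le le//=.
have := le a^-1 (a *: x); rewrite invr_gt0 a0 scalerA mulVf ?gt_eqF// scale1r.
by move=> /(_ isT); rewrite ler_pdivlMl.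
Qed.

(** Minimality forces [pushed p x = p], so [p (- x) <= - p x]; an odd
    sublinear functional is linear. *)
Lemma minimal_sublinear_linear p : sublinear p ->
    (forall q, sublinear q -> (forall x, q x <= p x) -> q = p) ->
  linear (p : V -> R^o).
Proof.
move=> sp pmin.
have pN x : p (- x) = - p x.
  apply/eqP; rewrite eq_le; apply/andP; split; last first.
    by have := sublinear_opp x sp; lra.
  have <- := pmin _ (pushed_sublinear x sp) (fun y => pushed_le x y sp).
  rewrite (le_trans (pushed_opp x sp))//.
  by have := pushed_le x x sp; rewrite lerN2.
have pD x y : p (x + y) = p x + p y.
  apply/eqP; rewrite eq_le sp.1/=.
  by have := sp.1 (x + y) (- y); rewrite addrK pN; lra.
have pZ a x : p (a *: x) = a * p x.
  have [a0|a0|->] := ltgtP a 0.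
  - by rewrite -[a]opprK scaleNr pN sp.2 ?oppr_gt0//; ring.
  - exact: sp.2.
  - by rewrite scale0r mul0r sublinear0.
by move=> a x y; rewrite pD pZ.
Qed.

(** The lower bound needed for [Zorn] below: the pointwise infimum is finite
    because [- p (- x)] bounds the whole chain, and it is subadditive because
    of two members of a chain the smaller one serves both summands. *)
Lemma chain_inf_sublinear p (F : set (V -> R)) :
    F !=set0 ->
    (forall q, F q -> sublinear q /\ forall x, q x <= p x) ->
    (forall q1 q2, F q1 -> F q2 ->
      (forall x, q1 x <= q2 x) \/ (forall x, q2 x <= q1 x)) ->
  exists2 q, sublinear q & forall q', F q' -> forall x, q x <= q' x.
Proof.
move=> [q0 Fq0] Fsub Ftot.
pose q x := inf [set r x | r in F].
have qlb r x : F r -> q x <= r x.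
  move=> Fr; apply: ge_inf; last by exists r.
  exists (- p (- x)) => _ [s Fs <-].
  have := sublinear_opp x (Fsub _ Fs).1; have := (Fsub _ Fs).2 (- x); lra.
have qglb c x : (forall r, F r -> c <= r x) -> c <= q x.
  move=> h; apply: lb_le_inf; first by exists (q0 x), q0.
  by move=> _ [r Fr <-]; exact: h.
exists q => [|r Fr x]; last exact: qlb.
split=> [x y|].
  rewrite -lerBlDr; apply: (qglb) => r1 Fr1; rewrite lerBlDl -lerBlDr.
  apply: qglb => r2 Fr2; have [r12|r21] := Ftot _ _ Fr1 Fr2.
    have := qlb _ (x + y) Fr1; have := (Fsub _ Fr1).1.1 x y; have := r12 y; lra.
  have := qlb _ (x + y) Fr2; have := (Fsub _ Fr2).1.1 x y; have := r21 x; lra.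
have le a x : 0 < a -> q (a *: x) <= a * q x.
  move=> a0; rewrite -ler_pdivrMl//; apply: qglb => r Fr.
  by rewrite ler_pdivrMl// -(Fsub _ Fr).1.2//; exact: qlb.
move=> a x a0; apply/eqP; rewrite eq_le le//=.
have := le a^-1 (a *: x); rewrite invr_gt0 a0 scalerA mulVf ?gt_eqF// scale1r.
by move=> /(_ isT); rewrite ler_pdivlMl.
Qed.

(** The analytic form of the Hahn-Banach theorem, by [Zorn] on sublinear
    functionals instead of partial linear ones: no extension by one dimension
    is needed. *)
Lemma linear_below_sublinear p : sublinear p ->
  exists2 f : V -> R^o, linear f & forall x, f x <= p x.
Proof.
move=> sp.
pose D := {q : V -> R | sublinear q /\ forall x, q x <= p x}.
pose leD (q1 q2 : D) := `[< forall x, sval q2 x <= sval q1 x >].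
have [q|r s t /asboolP rs /asboolP st|s t /asboolP st /asboolP ts|A Atot|q qmin]
    := @Zorn D leD.
- by apply/asboolP.
- by apply/asboolP => x; exact: le_trans (st x) (rs x).
- apply: eq_sig_hprop => [? ? ?|]; first exact: Prop_irrelevance.
  by apply/funext => x; apply/eqP; rewrite eq_le st ts.
- have [[q0 Aq0]|A0] := pselect (A !=set0); last first.
    exists (exist _ p (conj sp (fun x => lexx (p x)))) => q Aq.
    by exfalso; apply: A0; exists q.
  have [||q1 q2|q qsub qle] := @chain_inf_sublinear p (sval @` A).
  + by exists (sval q0), q0.
  + by move=> _ [q _ <-]; exact: (svalP q).
  + move=> [r1 Ar1 <-] [r2 Ar2 <-].
    by have [/asboolP ?|/asboolP ?] := Atot _ _ Ar1 Ar2; [right|left].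
  have qp x : q x <= p x.
    by apply: le_trans ((svalP q0).2 x); apply: qle; exists q0.
  exists (exist _ q (conj qsub qp)) => r Ar; apply/asboolP => x /=.
  by apply: qle; exists r.
have [qs qp] := svalP q.
exists (sval q) => //; apply: minimal_sublinear_linear => // r rs rq.
have rp x : r x <= p x by exact: le_trans (rq x) (qp x).
have := qmin (exist _ r (conj rs rp)).
by move=> /(_ (asboolT rq)) <-.
Qed.

Lemma norm_sublinear : sublinear (fun x : V => `|x|).
Proof.
split=> [x y|a x a0]; first exact: ler_normD.
by rewrite normrZ gtr0_norm.
Qed.

(** A linear functional below the norm pushed along [v] is at most [- `|v|]
    at [- v]. *)
Lemma norming_functional v :
  exists f : dual V, `|f| <= 1 /\ f v = `|v|.
Proof.
have sn := norm_sublinear.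
have [f flin fle] := linear_below_sublinear (pushed_sublinear v sn).
pose g : {linear V -> R^o} :=
  HB.pack f (GRing.isLinear.Build R V R^o *:%R f flin).
have gN x : f (- x) = - f x by exact: (raddfN g).
have fn x : f x <= `|x| by apply: le_trans (fle x) (pushed_le v x sn).
have fb x : `|f x| <= `|x|.
  rewrite ler_norml fn andbT lerNl -gN; apply: le_trans (fn _) _.
  by rewrite normrN.
have fB : f \in @bounded_linear_pred R V R^o.
  by apply/asboolP; split=> //; exists 1 => x; rewrite mul1r.
exists (BoundedOp fB); split.
  by apply: opnorm_le1 => x x1 /=; exact: le_trans (fb x) x1.
apply/eqP; rewrite eq_le fn/=.
have := le_trans (fle (- v)) (pushed_opp v sn).
by rewrite gN lerN2.
Qed.

End HahnBanach.

(** * Functionals, subspaces and distances *)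

Section Elementary.
Context {R : realType} {V : normedModType R}.

Lemma dual_le (f : dual V) v : `|f| <= 1 -> `|f v| <= `|v|.
Proof.
by move=> f1; rewrite (le_trans (opnormP f v))// -[leRHS]mul1r ler_wpM2r.
Qed.

Lemma dual_sumE (I : Type) (r : seq I) (c : I -> R) (f : I -> dual V) v :
  (\sum_(i <- r) c i *: f i) v = \sum_(i <- r) c i * f i v.
Proof. exact: (linear_sum (eval_at v)). Qed.

Lemma bidual_embedding_le (v : V) : `|bidual_embedding V v| <= `|v|.
Proof. by apply: opnorm_le1 => f f1; exact: dual_le. Qed.

Lemma subspace_sum (W : lin_subspace V) (I : Type) (r : seq I) (c : I -> R)
    (a : I -> V) :
  (forall i, subspace_set W (a i)) ->
  subspace_set W (\sum_(i <- r) c i *: a i).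
Proof.
move=> Wa; elim/big_ind: _ => [|p q Wp Wq|i _]; first exact: subspace0.
  by rewrite -[p]scale1r; exact: subspaceP.
by rewrite -[_ *: _]addr0; apply: subspaceP (subspace0 W).
Qed.

Lemma dist_to_le_norm (v : V) (W : lin_subspace V) : dist_to v W <= `|v|.
Proof.
apply: ge_inf; first by exists 0 => _ [w _ <-].
by exists 0; [exact: subspace0|rewrite subr0].
Qed.

Lemma le_dist_to (v : V) (W : lin_subspace V) c :
  (forall w, subspace_set W w -> c <= `|v - w|) -> c <= dist_to v W.
Proof.
move=> cW; apply: lb_le_inf.
  by exists `|v - 0|, 0 => //; exact: subspace0.
by move=> _ [w Ww <-]; exact: cW.
Qed.

End Elementary.

(** * Finite-dimensional linear algebra *)

(** A finite subfamily of maximal rank spans all the coordinate vectors. *)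
Lemma finite_coordinate_span (F : fieldType) (I : Type) (D : set I) n
    (c : I -> 'rV[F]_n) :
  exists m (a : 'I_m -> I), (forall i, D (a i)) /\
    forall x, D x -> (c x <= \matrix_i c (a i))%MS.
Proof.
pose attained (r : nat) := `[< exists m (a : 'I_m -> I),
  (forall i, D (a i)) /\ \rank (\matrix_i c (a i)) = r >].
have att0 : exists r, attained r.
  exists 0%N; apply/asboolP; exists 0%N.
  exists (fun i : 'I_0 => False_rect I (notF (ltn_ord i))).
  by split=> [[]//|]; apply/eqP; rewrite -leqn0 rank_leq_row.
have attn r : attained r -> (r <= n)%N.
  by move=> /asboolP[m [a [_ <-]]]; exact: rank_leq_col.
case: (ex_maxnP att0 attn) => r /asboolP[m [a [Da rka]]] rmax.
exists m, a; split=> // x Dx; apply: contraT => xa.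
pose a' (i : 'I_(m + 1)) :=
  match fintype.split i with inl j => a j | inr _ => x end.
have E : \matrix_i c (a' i) = col_mx (\matrix_i c (a i)) (c x).
  apply/row_matrixP => i; rewrite rowK /a'.
  by case: split_ordP => j ->; rewrite ?rowKu ?rowKd ?rowK// row_id.
have : attained (\rank (\matrix_i c (a' i))).
  apply/asboolP; exists (m + 1)%N, a'; split=> // i.
  by rewrite /a'; case: (fintype.split i).
move=> /rmax; rewrite leqNgt E -rka -addsmxE rank_ltmx//.
by rewrite ltmxE addsmxSl addsmx_sub submx_refl.
Qed.

(** Both values are read in coordinates: the vector [(f i y)_i] is in the span
    of the vectors [(f i z)_i], [z] in [Z], as soon as every linear form that
    kills the latter kills the former. *)
Lemma interpolation_in_subspace (R : realType) (V : normedModType R)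
    (Z : lin_subspace V) n (f : 'I_n -> dual V) (y : V) :
    (forall c : 'I_n -> R,
      subspace_set (annihilator Z) (\sum_i c i *: f i) ->
      (\sum_i c i *: f i) y = 0) ->
  exists2 z, subspace_set Z z & forall i, f i z = f i y.
Proof.
move=> fZ; pose v x : 'rV[R]_n := \row_i f i x.
have [m [a [Za aspan]]] := finite_coordinate_span (subspace_set Z) v.
have [/submxP[w vy]|] := boolP (v y <= \matrix_i v (a i))%MS.
  exists (\sum_i w 0 i *: a i).
    exact: subspace_sum.
  move=> i; have := congr1 (fun r : 'rV_n => r 0 i) vy.
  rewrite !mxE => ->; rewrite linear_sum; apply: eq_bigr => k _.
  by rewrite !mxE linearZ.
(* A column of the cokernel of [M] is a linear form killing the rows of [M]. *)
set M := \matrix_i v (a i) in aspan *.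
rewrite submxE => /eqP vy; exfalso; apply: vy; apply/rowP => j.
have vE x : (v x *m cokermx M) 0 j = (\sum_i cokermx M i j *: f i) x.
  by rewrite dual_sumE mxE; apply: eq_bigr => i _; rewrite mxE mulrC.
rewrite vE mxE; apply: fZ => z Zz; rewrite -vE.
by have := aspan z Zz; rewrite submxE => /eqP ->; rewrite mxE.
Qed.

Lemma linear_span_range (R : realType) (V : normedModType R) n
    (b : 'I_n -> V) v :
  linear_span (range b) v -> exists c : 'I_n -> R, v = \sum_i c i *: b i.
Proof.
move=> [m [c [a [ab ->]]]].
elim/big_ind: _ => [|p q [cp ->] [cq ->]|i _].
- by exists (fun=> 0); rewrite big1// => i _; rewrite scale0r.
- by exists (fun i => cp i + cq i); rewrite -big_split;
     apply: eq_bigr => i _; rewrite scalerDl.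
- have [k _ <-] := ab i; exists (fun j => if j == k then c i else 0).
  rewrite (bigD1 k)//= eqxx big1 ?addr0// => j /negbTE ->.
  by rewrite scale0r.
Qed.

(** * Operators of finite rank *)

Section FiniteRank.
Context {R : realType} {X Y : normedModType R}.

Definition finite_rank_fun (s : seq (dual X * Y)) (x : X) : Y :=
  \sum_(p <- s) p.1 x *: p.2.

Lemma finite_rank_bounded s : finite_rank_fun s \in @bounded_linear_pred R X Y.
Proof.
apply/asboolP; rewrite /finite_rank_fun; split=> [a x y|].
  rewrite scaler_sumr -big_split; apply: eq_bigr => p _ /=.
  by rewrite linearP scalerDl scalerA.
exists (\sum_(p <- s) `|p.1| * `|p.2|) => x.
rewrite mulr_suml (le_trans (ler_norm_sum _ _ _))//.
apply: ler_sum => p _; rewrite normrZ mulrAC ler_wpM2r//.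
exact: opnormP.
Qed.

Definition finite_rank_op s : bounded_op X Y :=
  BoundedOp (finite_rank_bounded s).

Lemma tensor_bounded (x : X) (f : dual Y) :
  (fun S : bounded_op X Y => f (S x)) \in
    @bounded_linear_pred R (bounded_op X Y) R^o.
Proof.
apply/asboolP; split=> [a S1 S2|]; first exact: linearP.
exists (`|f| * `|x|) => S; rewrite (le_trans (opnormP f _))//.
rewrite -mulrA ler_wpM2l ?opnorm_ge0// mulrC; exact: opnormP.
Qed.

Definition tensor x f : dual (bounded_op X Y) := BoundedOp (tensor_bounded x f).

End FiniteRank.

(** If [q] fixes [s] but moves [x] by [u], take [h] with [h u != 0]: adding
    [h (y - q y) / h u *: u] corrects the value at [x] and adds 0 at every
    point fixed by [q]. *)
Lemma finite_rank_fixing (R : realType) (X : normedModType R) (s : seq X) :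
  exists q : seq (dual X * X), forall x, x \in s -> finite_rank_fun q x = x.
Proof.
elim: s => [|x s [q qs]]; first by exists [::].
pose u := x - finite_rank_fun q x.
have [u0|u0] := eqVneq u 0.
  exists q => y; rewrite inE => /orP[/eqP ->|/qs//].
  by apply/eqP; rewrite eq_sym -subr_eq0 -/u u0.
have [h [_ hu]] := norming_functional u.
pose h' : dual X := `|u|^-1 *: (h - \sum_(p <- q) h p.2 *: p.1).
exists ((h', u) :: q).
have hE y : h' y = `|u|^-1 * h (y - finite_rank_fun q y).
  have -> : h' y = `|u|^-1 * (h y - (\sum_(p <- q) h p.2 *: p.1) y) by [].
  congr (_ * _); rewrite linearB; congr (_ - _).
  rewrite dual_sumE linear_sum; apply: eq_bigr => p _.
  by rewrite [RHS]linearZ; exact: mulrC.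
move=> y; rewrite /finite_rank_fun big_cons -/(finite_rank_fun q y) hE /=.
rewrite inE => /orP[/eqP ->|/qs ->].
  by rewrite hu mulVf ?normr_eq0// scale1r /u subrK.
by rewrite subrr linear0 mulr0 scale0r add0r.
Qed.

(** * Limits along an ultrafilter *)

Section UltrafilterLimits.

Lemma ultra_fmap (S T : Type) (f : S -> T) (U : set_system S) :
  UltraFilter U -> UltraFilter (f @ U).
Proof.
move=> UU; apply: Build_UltraFilter => G PG fUG; apply/seteqP; split=> // A GA.
have [//|UA] := in_ultra_setVsetC (f @^-1` A) UU.
exfalso; apply: (@filter_not_empty _ G PG).
by rewrite -(setICr A); apply: filterI => //; exact: fUG.
Qed.

Context {R : realType} (U : set_system nat) (UU : UltraFilter U).

Lemma ultra_bounded_cvg (r : nat -> R) (M : R) :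
  (forall n, `|r n| <= M) -> cvg (r @ U).
Proof.
move=> rM; have rU := ultra_fmap r UU.
have := @segment_compact R (- M) M; rewrite compact_ultra => /(_ _ rU).
have rMU : (r @ U) [set` `[- M, M]].
  apply: (@filterE _ U) => n; rewrite /= in_itv /= -ler_norml; exact: rM.
by move=> /(_ rMU)[l [_ rl]]; apply/cvg_ex; exists l.
Qed.

(** Weak-star compactness of the dual ball: bounded scalars converge along an
    ultrafilter, so the limit is defined pointwise. *)
Lemma ultra_weak_star_limit (V : normedModType R) (f : nat -> dual V) :
    (forall n, `|f n| <= 1) ->
  exists f0 : dual V, `|f0| <= 1 /\ forall v, f n v @[n --> U] --> f0 v.
Proof.
move=> f1.
have fle n v : `|f n v| <= `|v| by exact: dual_le.
pose g v : R^o := lim (f n v @[n --> U]).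
have fg v : f n v @[n --> U] --> g v.
  by apply: (@ultra_bounded_cvg (fun n => f n v) `|v|) => n; exact: fle.
have gle v : `|g v| <= `|v|.
  rewrite ler_norml; apply/andP; split.
    apply: limr_ge; first exact: fg.
    by apply: nearW => n; have := fle n v; rewrite ler_norml => /andP[].
  apply: limr_le; first exact: fg.
  by apply: nearW => n; have := fle n v; rewrite ler_norml => /andP[].
have gB : g \in @bounded_linear_pred R V R^o.
  apply/asboolP; split; last by exists 1 => v; rewrite mul1r.
  move=> a v w; apply: cvg_lim => //.
  under eq_fun do rewrite linearP.
  by apply: cvgD (fg w); apply: cvgZ (fg v); exact: cvg_cst.
exists (BoundedOp gB); split=> //.
by apply: opnorm_le1 => v v1; exact: le_trans (gle v) v1.
Qed.

Lemma ultra_weak_limit (V : normedModType R) (x : nat -> V) :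
    reflexive_space V -> (forall n, `|x n| <= 1) ->
  exists x0 : V, `|x0| <= 1 /\
    forall f : dual V, f (x n) @[n --> U] --> f x0.
Proof.
move=> reflV x1.
have [n|phi [phi1 xphi]] :=
    @ultra_weak_star_limit (dual V) (fun n => bidual_embedding V (x n)).
  by rewrite (le_trans (bidual_embedding_le _)).
have [x0 x0phi] := reflV phi; exists x0; split; last first.
  by move=> f; have := xphi f; rewrite -x0phi.
have [h [h1 <-]] := norming_functional x0.
rewrite -[leLHS]/(bidual_embedding V x0 h) x0phi (le_trans (ler_norm _))//.
by rewrite (le_trans (dual_le h phi1)).
Qed.

Lemma bounded_op_cvg (X Y : normedModType R) (T : bounded_op X Y)
    (x : nat -> X) (x0 : X) :
  x n @[n --> U] --> x0 -> T (x n) @[n --> U] --> T x0.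
Proof.
move=> xx0; have T0 : 0 < opnorm T + 1 by rewrite ltr_wpDl ?opnorm_ge0.
apply/cvgrPdist_le => e e0.
have d0 : 0 < e / (opnorm T + 1) by rewrite divr_gt0.
near=> n; rewrite -linearB.
rewrite (le_trans (opnormP T _))//.
rewrite (@le_trans _ _ ((opnorm T + 1) * `|x0 - x n|))//.
  by rewrite ler_wpM2r// lerDl.
rewrite mulrC -ler_pdivlMr//; near: n.
by move/cvgrPdist_le : xx0 => /(_ _ d0).
Unshelve. all: by end_near. Qed.

(** Compactness gives a norm limit of [T (x n)], and functionals identify it
    with [T x0]. *)
Lemma compact_op_weak_to_norm (X Y : normedModType R) (T : bounded_op X Y)
    (x : nat -> X) (x0 : X) :
    compact_op T -> (forall n, `|x n| <= 1) ->
    (forall f : dual X, f (x n) @[n --> U] --> f x0) ->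
  T (x n) @[n --> U] --> T x0.
Proof.
move=> cT x1 xx0.
have TU : UltraFilter (T (x n) @[n --> U]) by exact: ultra_fmap.
move: cT; rewrite /compact_op precompactE compact_ultra => /(_ _ TU)[].
  by apply: (@filterE _ U) => n; apply: subset_closure; exists (x n) => //=.
move=> v [_ Tv]; suff -> : T x0 = v by [].
apply/eqP; rewrite -subr_eq0 -normr_eq0.
have [h [_ <-]] := norming_functional (T x0 - v).
rewrite linearB subr_eq0; apply/eqP.
apply: (@cvg_unique _ (@norm_hausdorff _ R^o) (h (T (x n)) @[n --> U])).
  exact: (xx0 (comp_op h T)).
exact: bounded_op_cvg Tv.
Qed.

End UltrafilterLimits.

(** * Norming pairs *)

Section NormingPairs.
Context {R : realType} {X Y : normedModType R}.
Implicit Types (T S : bounded_op X Y) (x : X) (f : dual Y).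

Definition norming_pair T x f := [/\ `|x| <= 1, `|f| <= 1 & f (T x) = `|T|].

Lemma pairing_le S x f : `|x| <= 1 -> `|f| <= 1 -> `|f (S x)| <= `|S|.
Proof.
by move=> x1 f1; rewrite (le_trans (dual_le _ f1))//; exact: opnorm_ge1.
Qed.

Lemma norming_pair_attaining T x f :
  T <> 0 -> norming_pair T x f -> norm_attaining T x.
Proof.
move=> T0 [x1 f1 fTx].
have T0' : 0 < `|T| by rewrite normr_gt0; apply/eqP.
have TTx : `|T| <= `|T x|.
  by rewrite -fTx (le_trans (ler_norm _))// dual_le.
split=> /=; apply/eqP; rewrite eq_le ?TTx ?andbT.
  rewrite x1/= -(ler_pM2l T0') mulr1 (le_trans TTx)//.
  exact: opnormP.
exact: opnorm_ge1.
Qed.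

Lemma norming_pair_support T x f :
  T <> 0 -> norming_pair T x f -> support_functionals T (tensor x f).
Proof.
move=> T0 [x1 f1 fTx].
have T0' : 0 < `|T| by rewrite normr_gt0; apply/eqP.
split=> //=; apply/eqP; rewrite eq_le; apply/andP; split.
  apply: opnorm_le1 => S S1 /=; exact: le_trans (pairing_le S x1 f1) S1.
rewrite -(ler_pM2r T0') mul1r (le_trans _ (opnormP (tensor x f) T))//.
by rewrite /= fTx ler_norm.
Qed.

(** The functionals [tensor x f] of the norming pairs lie in the span of
    [J(T)], so they have coordinate vectors of a fixed length. *)
Lemma norming_pairs_finitely_generated T :
    multi_smooth_finite_order T ->
  exists m (x : 'I_m -> X) (f : 'I_m -> dual Y),
    (forall i, norming_pair T (x i) (f i)) /\
    forall x' f', norming_pair T x' f' ->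
      exists w : 'I_m -> R,
        forall S, f' (S x') = \sum_i w i * f i (S (x i)).
Proof.
move=> [T0 [n [b spanE]]].
pose D := [set p : X * dual Y | norming_pair T p.1 p.2].
have coord p : exists c : 'rV[R]_n,
    D p -> tensor p.1 p.2 = \sum_k c 0 k *: b k.
  have [Dp|nDp] := pselect (D p); last by exists 0.
  have : linear_span (support_functionals T) (tensor p.1 p.2).
    exists 1%N, (fun=> 1), (fun=> tensor p.1 p.2); split=> [_|].
      exact: norming_pair_support.
    by rewrite big_ord1 scale1r.
  rewrite spanE => /linear_span_range[c ->].
  by exists (\row_k c k) => _; apply: eq_bigr => k _; rewrite mxE.
have [c cE] := choice coord.
have [m [a [Da aspan]]] := finite_coordinate_span D c.
exists m, (fun i => (a i).1), (fun i => (a i).2); split=> // x f Dxf.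
have /submxP[w cw] := aspan (x, f) Dxf.
exists (w 0) => S.
have tE p : D p -> p.2 (S p.1) = \sum_k c p 0 k * b k S.
  move=> /cE tp; rewrite -[LHS]/(tensor p.1 p.2 S) tp.
  exact: dual_sumE.
rewrite (tE (x, f) Dxf) cw.
under [RHS]eq_bigr => i _ do rewrite tE// mulr_sumr.
rewrite exchange_big; apply: eq_bigr => k _ /=.
rewrite mxE mulr_suml; apply: eq_bigr => i _.
by rewrite mxE mulrA.
Qed.

(** The nontrivial half of the characterization of Birkhoff-James
    orthogonality by norming pairs.  Finite rank makes [f (S x)] jointly
    continuous for the weak and weak-star limits taken here. *)
Lemma norming_pair_of_perturbations T (s : seq (dual X * Y)) :
    reflexive_space X -> compact_op T ->
    (forall l : R, `|T| <= `|T - l *: finite_rank_op s|) ->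
  exists x f, norming_pair T x f /\ f (finite_rank_op s x) <= 0.
Proof.
set S := finite_rank_op s => reflX cT Tle.
pose l n : R := n.+1%:R^-1.
have l0 n : 0 < l n by rewrite invr_gt0.
(* The error [l n * l n] is negligible with respect to the coefficient [l n]:
   dividing by [l n] still gives [f n (S (x n)) <= l n]. *)
have /choice[p pP] n : exists p : X * dual Y,
    [/\ `|p.1| <= 1, `|p.2| <= 1 &
      `|T| - l n * l n <= p.2 (T p.1) - l n * p.2 (S p.1)].
  have ll0 : 0 < l n * l n by rewrite mulr_gt0.
  have := sup_adherent ll0 (opnorm_has_sup (T - l n *: S)).
  move=> [_ [x /= x1 <-] xT].
  have [f [f1 fx]] := norming_functional ((T - l n *: S) x).
  exists (x, f); split=> //=.
  have -> : f (T x) - l n * f (S x) = f ((T - l n *: S) x).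
    have -> : (T - l n *: S) x = T x - l n *: S x by [].
    by rewrite [RHS]linearB; congr (_ - _); rewrite [RHS]linearZ.
  rewrite fx (le_trans _ (ltW xT))// lerB//; exact: Tle.
have [U [UU nU]] := @ultraFilterLemma _ \oo _.
pose x n := (p n).1; pose f n := (p n).2.
have x1 n : `|x n| <= 1 by case: (pP n).
have f1 n : `|f n| <= 1 by case: (pP n).
have [x0 [x01 xx0]] := ultra_weak_limit UU reflX x1.
have [f0 [f01 ff0]] := ultra_weak_star_limit UU f1.
have lU : l n @[n --> U] --> (0 : R).
  by apply: cvg_trans (@cvg_harmonic R); exact: cvg_app.
have fT : f n (T (x n)) @[n --> U] --> f0 (T x0).
  have TxTx0 := compact_op_weak_to_norm UU cT x1 xx0.
  (* Split [f n (T (x n))] as [f n (T x0)] plus [f n (T (x n) - T x0)]. *)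
  rewrite -[f0 (T x0)]addr0.
  under eq_fun => n do rewrite -[f n _](subrK (f n (T x0))) addrC.
  apply: cvgD; first exact: ff0.
  apply/cvgrPdist_le => e e0; near=> n.
  rewrite sub0r normrN -linearB (le_trans (dual_le _ (f1 n)))//.
  rewrite distrC; near: n.
  by move/cvgrPdist_le : TxTx0 => /(_ _ e0).
have fS : f n (S (x n)) @[n --> U] --> f0 (S x0).
  under eq_fun => n do rewrite linear_sum.
  rewrite linear_sum; apply: cvg_big => [|q _]; first exact: add_continuous.
  under eq_fun => n do rewrite linearZ.
  rewrite linearZ; apply: cvgM; [exact: xx0|exact: ff0].
exists x0, f0.
have f0T : f0 (T x0) = `|T|.
  apply/eqP; rewrite eq_le (le_trans (ler_norm _) (pairing_le T x01 f01))/=.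
  have limL : `|T| - l n * l n @[n --> U] --> `|T| - 0 * 0.
    by apply: cvgB; [exact: cvg_cst|exact: cvgM].
  have limR : f n (T (x n)) - l n * f n (S (x n)) @[n --> U] -->
      f0 (T x0) - 0 * f0 (S x0).
    by apply: cvgB => //; exact: cvgM.
  rewrite !mul0r !subr0 in limL limR.
  by apply: (ler_cvg_to limL limR); apply: nearW => n; case: (pP n).
split=> //.
apply: (ler_cvg_to fS lU); apply: nearW => n.
have [_ _] := pP n; rewrite -/(x n) -/(f n) => pn.
rewrite -(ler_pM2l (l0 n)) -lerN2 -(lerD2l `|T|) (le_trans pn)// lerD2r.
exact: le_trans (ler_norm _) (pairing_le T (x1 n) (f1 n)).
Unshelve. all: by end_near. Qed.

End NormingPairs.

(** * Norming pairs that annihilate an M-ideal *)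

(** If [P f != f], normalize [f - P f]: since [`|f| <= 1] is the sum of the
    norms of [P f] and [f - P f], the full value [`|T|] can be reached at
    [T x] only if both parts reach their norms times [`|T|] there. *)
Lemma M_ideal_norming_pair (R : realType) (X Y : normedModType R)
    (P : {linear dual Y -> dual Y}) (T : bounded_op X Y) x f :
    (forall g, P (P g) = P g) -> (forall g, `|g| = `|P g| + `|g - P g|) ->
    norming_pair T x f ->
  P f = f \/ exists2 g, norming_pair T x g & P g = 0.
Proof.
move=> PP Pnorm [x1 f1 fTx]; have [Pf|w0] := eqVneq (f - P f) 0.
  by left; apply/esym/eqP; rewrite -subr_eq0 Pf.
right; set w := f - P f in w0.
have nw : 0 < `|w| by rewrite normr_gt0.
have g1 : `|(`|w|^-1 *: w)| = 1 by rewrite normrZ normfV normr_id mulVf ?gt_eqF.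
exists (`|w|^-1 *: w); last first.
  by rewrite linearZ /w linearB PP subrr; exact: scaler0.
split; rewrite ?g1//; apply/eqP; rewrite eq_le.
rewrite (le_trans (ler_norm _) (pairing_le T x1 _)) ?g1//=.
rewrite -[leRHS]/(`|w|^-1 * (f (T x) - P f (T x))) ler_pdivlMl// fTx.
have PfT : P f (T x) <= `|P f| * `|T|.
  rewrite (le_trans (ler_norm _))// (le_trans (opnormP _ _))//.
  by rewrite ler_wpM2l ?opnorm_ge0//; exact: opnorm_ge1.
have fw : (`|P f| + `|w|) * `|T| <= `|T|.
  by rewrite -Pnorm -[leRHS]mul1r ler_wpM2r.
by rewrite mulrDl in fw; lra.
Qed.

(** The heart of the proof: otherwise every norming functional is in the range
    of [P], and a finite-rank operator into [Z] reproduces the values of [T]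
    on all norming pairs. *)
Lemma exists_annihilating_norming_pair (R : realType) (X Y : normedModType R)
    (Z : lin_subspace Y) (T : bounded_op X Y) :
    reflexive_space X -> M_ideal Z -> compact_op T ->
    multi_smooth_finite_order T -> bj_orth_subspace T (ops_into X Z) ->
  exists x f, norming_pair T x f /\ subspace_set (annihilator Z) f.
Proof.
move=> reflX [_ [P [PP kerP Pnorm]]] cT smT TZ; have T0 := smT.1.
have annP g : subspace_set (annihilator Z) g <-> P g = 0.
  by rewrite -kerP.
apply/not_existsP => /= nex.
have Pfix x f : norming_pair T x f -> P f = f.
  move=> xf; have [//|[g xg Pg]] := M_ideal_norming_pair PP Pnorm xf.
  by exfalso; apply: (nex x); exists g; split=> //; apply/annP.
have [m [x [f [xf span]]]] := norming_pairs_finitely_generated smT.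
have [q qx] := finite_rank_fixing [seq x i | i : 'I_m].
have /choice[z zP] u :
    exists z, subspace_set Z z /\ forall i, f i z = f i (T u).
  have [c /annP|z Zz fz] := @interpolation_in_subspace _ _ Z _ f (T u).
    rewrite linear_sum => cf; suff -> : \sum_i c i *: f i = 0 by [].
    rewrite -[RHS]cf; apply: eq_bigr => i _.
    by rewrite linearZ/= (Pfix _ _ (xf i)).
  by exists z.
pose S := finite_rank_op [seq (p.1, z p.2) | p <- q].
have SE y : S y = \sum_(p <- q) p.1 y *: z p.2.
  by rewrite /S /= /finite_rank_fun big_map.
have SZ : subspace_set (ops_into X Z) S.
  by move=> y; rewrite SE; apply: subspace_sum => p; exact: (zP _).1.
have fS i : f i (S (x i)) = f i (T (x i)).
  have {2}<- : finite_rank_fun q (x i) = x i.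
    by apply: qx; apply: map_f; rewrite mem_enum.
  rewrite SE !linear_sum; apply: eq_bigr => p _.
  by rewrite !linearZ /= (zP _).2.
have TS l : `|T| <= `|T - l *: S| by rewrite -scaleNr; exact: TZ.
have [x0 [f0 [xf0 fSx0]]] := norming_pair_of_perturbations reflX cT TS.
have [w wE] := span _ _ xf0.
have : f0 (S x0) = `|T|.
  case: xf0 => _ _ <-; rewrite !wE.
  by apply: eq_bigr => i _; rewrite fS.
move=> E; move: fSx0; rewrite E normr_le0 => /eqP; exact: T0.
Qed.

(** * Distances and orthogonality *)

Theorem corollary2p4 (R : realType) (X Y : completeNormedModType R)
    (Z : lin_subspace Y) (T : bounded_op X Y) :
  reflexive_space X ->
  closed (Z : set Y) ->
  L1_predual (subspace_type Z) ->
  M_ideal Z ->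
  compact_op T ->
  multi_smooth_finite_order T ->
  bj_orth_subspace T (ops_into X Z) ->
  exists2 x0 : X, norm_attaining T x0 &
    [/\ dist_to T (ops_into X Z) =
          sup [set dist_to (T x) Z | x in unit_sphere X]
        /\ sup [set dist_to (T x) Z | x in unit_sphere X] =
            dist_to (T x0) Z,
        bj_orth_subspace (bidual_embedding Y (T x0))
          (annihilator (annihilator Z))
      & bj_orth_subspace (comp_op (bidual_embedding Y) T)
          (ops_into X (annihilator (annihilator Z)))].
Proof.
move=> reflX _ _ MZ cT smT TZ.
have [x0 [f [xf Zf]]] := exists_annihilating_norming_pair reflX MZ cT smT TZ.
have x0T := norming_pair_attaining smT.1 xf.
have [x01 f1 fTx0] := xf; have [x0S Tx0] := x0T.
have dT : dist_to T (ops_into X Z) = `|T|.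
  apply/eqP; rewrite eq_le dist_to_le_norm/=; apply: le_dist_to => S SZ.
  by rewrite -scaleN1r; exact: TZ.
have dTx0 : dist_to (T x0) Z = `|T|.
  apply/eqP; rewrite eq_le -{1}Tx0 dist_to_le_norm/=; apply: le_dist_to => z Zz.
  rewrite -fTx0 -[f (T x0)]subr0 -(Zf z Zz) -linearB.
  by rewrite (le_trans (ler_norm _))// dual_le.
have supT : sup [set dist_to (T x) Z | x in unit_sphere X] = `|T|.
  have ubT : ubound [set dist_to (T x) Z | x in unit_sphere X] `|T|.
    move=> _ [x x1 <-]; rewrite (le_trans (dist_to_le_norm _ _))//.
    by apply: opnorm_ge1; rewrite x1.
  apply/eqP; rewrite eq_le; apply/andP; split.
    by apply: ge_sup => //; exists (dist_to (T x0) Z), x0.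
  by rewrite -{1}dTx0; apply: ub_le_sup; [exists (`|T|)|exists x0].
have orth (phi : dual (dual Y)) :
    phi f = 0 -> `|T| <= `|bidual_embedding Y (T x0) + phi|.
  move=> phif; rewrite -fTx0 -[leLHS]addr0 -phif.
  rewrite -[leLHS]/((bidual_embedding Y (T x0) + phi) f).
  rewrite (le_trans (ler_norm _))// (le_trans (opnormP _ _))//.
  by rewrite -[leRHS]mulr1 ler_wpM2l// opnorm_ge0.
exists x0 => //; split; first by rewrite dT supT dTx0.
  move=> phi phiZ l; rewrite (le_trans (bidual_embedding_le _))// Tx0.
  apply: orth; rewrite -[LHS]/(l * phi f) phiZ ?mulr0//.
move=> S SZ l; apply: (@le_trans _ _ `|T|).
  apply: opnorm_le1 => x xle1; rewrite (le_trans (bidual_embedding_le _))//.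
  exact: opnorm_ge1.
rewrite (le_trans (orth (l *: S x0) _))//.
  by rewrite -[LHS]/(l * S x0 f) SZ ?mulr0.
exact: (@opnorm_ge1 _ _ _ (comp_op (bidual_embedding Y) T + l *: S)).
Qed.
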